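(* Let $G$ be a finite connected graph (loops and multiple edges allowed) and let $\alpha(G)$ denote the number of Eulerian equivalence classes of $\mathcal{BO}(G)$. Then $$\alpha(G)=T_G(0,1),$$ where $T_G(x,y)$ is the Tutte polynomial of $G$. Equivalently, $\alpha(G)$ equals the number of spanning trees of $G$ having no internally active edge with respect to any fixed total order on $E(G)$.
   Context: An orientation of $G=(V,E)$ assigns a direction to each edge. For a partition $V=S\sqcup T$ with $S,T\neq\emptyset$, $[S,T]$ denotes the set of edges joining $S$ and $T$ (a cut); a bond is a minimal nonempty cut. For an orientation $\varepsilon$, $(S,T)_\varepsilon$ is the set of edges of $[S,T]$ directed from $S$ to $T$. A bond $[S,T]$ is directed (relative to $\varepsilon$) if $(S,T)_\varepsilon=\emptyset$ or $(T,S)_\varepsilon=\emptyset$; a cut is directed if it is a disjoint union of directed bonds. $\mathcal{BO}(G)$ is the set of orientations of $G$ having no (nonempty) directed cut; for connected $G$ these are exactly the totally cyclic orientations (every edge lies on a directed cycle). Two orientations $\varepsilon_1,\varepsilon_2$ are Eulerian equivalent if the spanning subgraph formed by the edges $\{e:\varepsilon_1(e)\neq\varepsilon_2(e)\}$, oriented by $\varepsilon_1$, has in-degree equal to out-degree at every vertex. The Tutte polynomial is defined by $T_{E_n}=1$ for the edgeless graph $E_n$, $T_G=xT_{G/e}$ if $e$ is a bridge, $T_G=yT_{G-e}$ if $e$ is a loop, and $T_G=T_{G-e}+T_{G/e}$ otherwise. Given a total order on $E$ and a spanning tree $F$, an edge $f\in F$ is internally active if it is the smallest edge of the cut $\{e\in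 E: (F-f)+e \text{ is a spanning tree}\}$; one has $T_G(x,y)=\sum_{i,j}t_{ij}x^iy^j$ where $t_{ij}$ is the number of spanning trees with exactly $i$ internally active and $j$ externally active edges. *)

(* Defs.v *)
From HB Require Import structures.
From mathcomp Require Import all_boot all_order all_algebra.
Set Implicit Arguments. Unset Strict Implicit. Unset Printing Implicit Defensive.
Import GRing.Theory.

(* A finite multigraph (loops and parallel edges allowed): vertex type, edge
   type, and for each edge its pair of endpoints (a reference labelling,
   used only to describe orientations). *)
Record graph := Graph { gV : finType; gE : finType; gends : gE -> gV * gV }.

Section Graphs.
Variable G : graph.
Local Notation V := (gV G).
Local Notation E := (gE G).
Local Notation src e := (gends e).1.
Local Notation tgt e := (gends e).2.

Definition adjS (F : {set E}) : rel V :=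
  fun u v => [exists e in F, (gends e == (u, v)) || (gends e == (v, u))].

Definition connectsAll (F : {set E}) : bool :=
  [forall u, forall v, connect (adjS F) u v].

Definition gconnected : bool := connectsAll setT.

Definition is_loop (e : E) : bool := src e == tgt e.

Definition is_bridge (e : E) : bool :=
  ~~ connect (adjS (setT :\ e)) (src e) (tgt e).

(* eps e = true : e directed src -> tgt ; false : tgt -> src *)
Definition orientation := {ffun E -> bool}.
Definition tail (eps : orientation) (e : E) : V := if eps e then src e else tgt e.
Definition head (eps : orientation) (e : E) : V := if eps e then tgt e else src e.

Definition cutset (S : {set V}) : {set E} :=
  [set e | (src e \in S) != (tgt e \in S)].

Definition proper_side (S : {set V}) : bool := (S != set0) && (S != setT).

Definition is_cut (C : {set E}) : bool :=
  [exists S : {set V}, proper_side S && (C == cutset S)].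

Definition is_bond (C : {set E}) : bool :=
  [&& is_cut C, C != set0 &
      [forall D : {set E}, (is_cut D && (D != set0) && (D \subset C)) ==> (D == C)]].

Definition dir_from (eps : orientation) (S : {set V}) : {set E} :=
  [set e in cutset S | (tail eps e \in S) && (head eps e \notin S)].

Definition directed_bond (eps : orientation) (C : {set E}) : bool :=
  is_bond C &&
  [exists S : {set V}, [&& proper_side S, C == cutset S &
       (dir_from eps S == set0) || (dir_from eps (~: S) == set0)]].

Definition directed_cut (eps : orientation) (C : {set E}) : bool :=
  is_cut C &&
  [exists P : {set {set E}},
     [&& trivIset P, [forall B in P, directed_bond eps B] & cover P == C]].

Definition BO : {set orientation} :=
  [set eps | [forall C : {set E}, (C != set0) ==> ~~ directed_cut eps C]].

Definition eul_equiv (e1 e2 : orientation) : bool :=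
  let D := [set e | e1 e != e2 e] in
  [forall v, #|[set e in D | head e1 e == v]| == #|[set e in D | tail e1 e == v]|].

Definition alpha : nat :=
  #|[set [set e2 in BO | eul_equiv e1 e2] | e1 in BO]|.

Definition spanning_tree (F : {set E}) : bool :=
  connectsAll F && [forall f in F, ~~ connectsAll (F :\ f)].

Definition fund_cut (F : {set E}) (f : E) : {set E} :=
  [set e | spanning_tree ((F :\ f) :|: [set e])].

(* total order on E given by an injective ranking r *)
Definition int_active (r : E -> nat) (F : {set E}) (f : E) : bool :=
  (f \in F) && [forall e in fund_cut F f, r f <= r e].

Definition trees_no_int_active (r : E -> nat) : nat :=
  #|[set F : {set E} | spanning_tree F && [forall f in F, ~~ int_active r F f]]|.

End Graphs.

Definition del (G : graph) (e : gE G) : graph :=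
  @Graph (gV G) {f : gE G | f != e} (fun f => gends (val f)).

Lemma contr_map_proof (G : graph) (e : gE G)
    (H : (gends e).1 != (gends e).2) (w : gV G) :
  (if w == (gends e).2 then (gends e).1 else w) != (gends e).2.
Proof. case E: (w == (gends e).2). by []. by rewrite E. Qed.

Definition contr_vmap (G : graph) (e : gE G)
    (H : (gends e).1 != (gends e).2) (w : gV G) : {w : gV G | w != (gends e).2} :=
  exist (fun x : gV G => x != (gends e).2) _ (contr_map_proof H w).

Definition contr (G : graph) (e : gE G) (H : (gends e).1 != (gends e).2) : graph :=
  @Graph {w : gV G | w != (gends e).2} {f : gE G | f != e}
    (fun f => (contr_vmap H (gends (val f)).1, contr_vmap H (gends (val f)).2)).

(* Tutte polynomial via deletion-contraction, as a relation.
   Bivariate polynomials over int: outer variable x = 'X,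
   inner variable y = ('X : {poly int})%:P. *)
Definition tx : {poly {poly int}} := 'X.
Definition ty : {poly {poly int}} := ('X : {poly int})%:P.

Inductive tutte : graph -> {poly {poly int}} -> Prop :=
| tutte_edgeless G : #|gE G| = 0 -> tutte G 1
| tutte_bridge G (e : gE G) (H : (gends e).1 != (gends e).2) p :
    is_bridge e -> tutte (contr H) p -> tutte G (tx * p)
| tutte_loop G (e : gE G) p : is_loop e -> tutte (del e) p -> tutte G (ty * p)
| tutte_other G (e : gE G) (H : (gends e).1 != (gends e).2) p q :
    ~~ is_bridge e -> tutte (del e) p -> tutte (contr H) q -> tutte G (p + q).

Definition eval2 (T : {poly {poly int}}) (a b : int) : int := (T.[a%:P]).[b].

(* Main.v *)
Require Import Defs.
From HB Require Import structures.
From mathcomp Require Import all_boot all_order all_algebra zify.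
Set Implicit Arguments. Unset Strict Implicit. Unset Printing Implicit Defensive.

(** Two orientations are Eulerian equivalent iff they have the same outdegrees, and
    for connected [G] an orientation lies in [BO G] iff every proper vertex set has
    an outgoing edge.  With Hakimi's theorem this makes [alpha G] the number of
    [d : V -> nat] whose sum is [#|E|] and whose sum over every proper side [S]
    exceeds the number of edges inside [S].  For an edge [e] with ends [u != v] that
    is not a bridge, adding [1] at [u] embeds the sequences of [G - e] into those of
    [G]; over each sequence of [G / e] the fibre in [G] is an interval in the
    coordinate [u], and the embedding misses exactly its least element.  So [alpha]
    obeys the recursion of [T(0, 1)].  The trees without internally active edge obey
    it as well when the largest edge is deleted and contracted. *)

(* [seq.head] would otherwise shadow the head of an edge. *)
Local Notation head := Defs.head.

(** * Cuts, connectivity and strong orientations *)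

Section Cuts.
Variable G : graph.
Local Notation V := (gV G).
Local Notation E := (gE G).
Local Notation src e := (gends e).1.
Local Notation tgt e := (gends e).2.
Implicit Types (S T : {set V}) (F : {set E}) (e f g : E) (eps : orientation G).

(** Symmetric difference of vertex sets, in the form that makes taking cuts additive modulo 2. *)
Definition symd S T : {set V} := [set x | (x \in S) (+) (x \in T)].

Lemma cutset_symd S T e :
  (e \in cutset (symd S T)) = (e \in cutset S) (+) (e \in cutset T).
Proof.
by rewrite !inE; case: (_ \in S); case: (_ \in T); case: (_ \in S); case: (_ \in T).
Qed.

Lemma cutsetC S : cutset (~: S) = cutset S.
Proof. by apply/setP => e; rewrite !inE; case: (_ \in S); case: (_ \in S). Qed.

Lemma proper_sideC S : proper_side (~: S) = proper_side S.
Proof.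
by rewrite /proper_side andbC -{1}setC0 -{2}setCT !(inj_eq (@setC_inj _)).
Qed.

Lemma proper_side_sep S x y : x \in S -> y \notin S -> proper_side S.
Proof.
move=> xS yS; apply/andP; split; first by apply/set0Pn; exists x.
by apply/eqP => ST; rewrite ST inE in yS.
Qed.

Lemma proper_side_ex S : proper_side S -> exists x y, x \in S /\ y \notin S.
Proof.
case/andP => /set0Pn[x xS]; rewrite -subTset => /subsetPn[y _ yS].
by exists x, y.
Qed.

Lemma cutset_proper S e : e \in cutset S -> proper_side S.
Proof.
rewrite inE; case a: (src e \in S); case b: (tgt e \in S) => // _.
  by apply: (@proper_side_sep _ (src e) (tgt e)); rewrite ?a ?b.
by apply: (@proper_side_sep _ (tgt e) (src e)); rewrite ?a ?b.
Qed.

(** A path from [x] to [y] must leave [S] somewhere; conversely, no edge of [F] leaves the set of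
    vertices reachable from [x]. Connectivity is handled through cuts from here on. *)
Lemma connect_cutP F x y :
  reflect (forall S, x \in S -> y \notin S -> exists2 f, f \in F & f \in cutset S)
          (connect (adjS F) x y).
Proof.
apply: (iffP idP) => [/connectP[p]|H].
  elim: p x => [|z p IH] x /= => [_ -> S -> //|/andP[adj pth] lst S xS yS].
  case zS: (z \in S); first exact: (IH z).
  case/exists_inP: adj => f fF /orP[]/eqP ef; exists f; rewrite // inE ef /=;
    by rewrite xS zS.
apply: contraT => ncon.
case: (H [set z | connect (adjS F) x z]); rewrite ?inE ?connect0 // => f fF.
have st : connect (adjS F) x (src f) = connect (adjS F) x (tgt f).
  have adj : adjS F (src f) (tgt f).
    by apply/exists_inP; exists f; rewrite -?surjective_pairing ?eqxx.
  have jda : adjS F (tgt f) (src f).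
    by apply/exists_inP; exists f; rewrite -?surjective_pairing ?eqxx ?orbT.
  by apply/idP/idP => h; apply: (connect_trans h); apply: connect1.
by rewrite !inE st eqxx.
Qed.

Lemma connectsAllP F :
  reflect (forall S, proper_side S -> exists2 f, f \in F & f \in cutset S)
          (connectsAll F).
Proof.
apply: (iffP idP) => [/forallP H S /proper_side_ex[x [y [xS yS]]]|H].
  by move/forallP/(_ y)/connect_cutP: (H x); apply.
apply/forallP => x; apply/forallP => y; apply/connect_cutP => S xS yS.
exact/H/(proper_side_sep xS yS).
Qed.

Lemma connectsAllPn F :
  reflect (exists2 S, proper_side S & forall f, f \in F -> f \notin cutset S)
          (~~ connectsAll F).
Proof.
apply: (iffP idP) => [nc|[S pS nF]]; last first.
  by apply/connectsAllP => /(_ S pS)[f /nF /negP].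
case: (boolP [exists S, proper_side S && [forall f in F, f \notin cutset S]]).
  by case/existsP=> S /andP[pS /forall_inP]; exists S.
move=> nex; case/negP: nc; apply/connectsAllP => S pS.
move/existsPn/(_ S): nex; rewrite pS => /forall_inPn[f fF].
by rewrite negbK; exists f.
Qed.

Lemma connectsAll_sub F F' : F \subset F' -> connectsAll F -> connectsAll F'.
Proof.
move=> /subsetP sub /connectsAllP c; apply/connectsAllP => S /c[f fF fS].
by exists f; rewrite ?sub.
Qed.

Lemma loop_cutset e S : is_loop e -> e \notin cutset S.
Proof. by rewrite inE => /eqP->; rewrite eqxx. Qed.

Lemma bridge_cutset e : is_bridge e ->
  exists S, [/\ src e \in S, tgt e \notin S & cutset S = [set e]].
Proof.
move=> br.
have [S /and3P[sS tS /eqP cS]|nS] :=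
    pickP [pred S : {set V} | [&& src e \in S, tgt e \notin S & cutset S == [set e]]].
  by exists S.
case/negP: br; apply/connect_cutP => S sS tS.
move: (nS S); rewrite /= sS tS /= => /negbT ne.
have eS : e \in cutset S by rewrite inE sS (negbTE tS).
have [f /andP[fe fS]|nf] := pickP [pred f | (f != e) && (f \in cutset S)].
  by exists f; rewrite // !inE fe.
case/eqP: ne; apply/setP => f; rewrite in_set1.
by have [->//|fe] := eqVneq f e; move: (nf f); rewrite /= fe.
Qed.

Lemma nonbridge_cutset e S : ~~ is_bridge e -> e \in cutset S ->
  exists2 g, g != e & g \in cutset S.
Proof.
rewrite negbK => /connect_cutP H eS.
suff [T [sT tT cT]] : exists T, [/\ src e \in T, tgt e \notin T & cutset T = cutset S].
  by have [g] := H T sT tT; rewrite cT !inE andbT; exists g; rewrite ?inE.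
move: (eS); rewrite inE.
case a: (src e \in S); case b: (tgt e \in S) => // _.
  by exists S; split; rewrite ?b.
by exists (~: S); rewrite cutsetC !inE a b.
Qed.

Lemma gconnected_cut S : gconnected G -> proper_side S -> exists f, f \in cutset S.
Proof. by move=> /connectsAllP H /H[f _ fS]; exists f. Qed.

(** Strong connectivity in terms of cuts: applied to [~: S] it also yields an edge entering [S]. *)
Definition strong eps : bool :=
  [forall S : {set V}, proper_side S ==> (dir_from eps S != set0)].

Lemma in_dir_from eps S f :
  (f \in dir_from eps S) = (tail eps f \in S) && (head eps f \notin S).
Proof.
rewrite !inE /tail /head.
by case: (eps f); case: (_ \in S); case: (_ \in S).
Qed.

Lemma in_cutset_eps eps S f :
  (f \in cutset S) = ((tail eps f \in S) != (head eps f \in S)).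
Proof. by rewrite inE /tail /head; case: (eps f) => //; rewrite eq_sym. Qed.

(* A directed cut whose edge set has minimum size is a bond: if a smaller cut [T]
   has its edges inside that of [S], then one of the intersections or unions of [S]
   with [T] or [~: T] spans a smaller nonempty directed cut. *)
Lemma BO_strong eps : gconnected G -> (eps \in BO G) = strong eps.
Proof.
move=> conn; apply/idP/idP; last first.
  move=> /forallP str; rewrite inE; apply/forallP => C; apply/implyP => C0.
  apply/negP => /andP[_ /existsP[P /and3P[_ /forall_inP dP /eqP covP]]].
  move: C0; rewrite -covP => /set0Pn[f /bigcupP[B /dP/andP[_]]].
  case/existsP => S /and3P[pS _ /orP[]/eqP d0] _.
    by move: (str S); rewrite pS d0 eqxx.
  by move: (str (~: S)); rewrite proper_sideC pS d0 eqxx.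
rewrite inE; apply: contraLR; rewrite negb_forall => /existsP[S0].
rewrite negb_imply negbK => ps0.
pose P S := proper_side S && (dir_from eps S == set0).
case: (@arg_minnP _ S0 P (fun S => #|cutset S|)); first exact: ps0.
move=> S /andP[pS /eqP dS] minS.
apply/forallPn; exists (cutset S).
have [f0 f0S] := gconnected_cut conn pS.
have S0n : cutset S != set0 by apply/set0Pn; exists f0.
rewrite negb_imply S0n /= negbK.
suff bd : is_bond (cutset S).
  rewrite /directed_cut; apply/andP; split; first by case/and3P: bd.
  apply/existsP; exists [set cutset S]; apply/and3P; split.
  - by apply/trivIsetP => A B /set1P-> /set1P->; rewrite eqxx.
  - apply/forall_inP => B /set1P->; rewrite /directed_bond bd.
    by apply/existsP; exists S; rewrite pS dS !eqxx.
  - by rewrite /cover big_set1.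
apply/and3P; split => //.
  by apply/existsP; exists S; rewrite pS eqxx.
apply/forallP => D; apply/implyP => /andP[/andP[/existsP[T /andP[pT /eqP ->]] T0] /subsetP sub].
have nS f : tail eps f \in S -> head eps f \in S.
  by move=> tS; apply: contraT => hS; have := in_dir_from eps S f; rewrite dS inE tS hS.
rewrite eqEsubset; apply/andP; split; first exact/subsetP.
case/set0Pn: T0 => f fT; apply/subsetP => g gS; apply: contraT => gT.
(* [det A] means that every edge crossing [A] crosses [S]. If moreover no edge leaves [A],
   minimality of [S] forbids that [f] crosses [A] and [g] does not. *)
pose det (A : {set V}) := forall h, h \notin cutset S -> (tail eps h \in A) = (head eps h \in A).
have detS : det S by move=> h; rewrite (in_cutset_eps eps) negbK => /eqP.
have detT : det T.
  by move=> h /(contra (sub h)); rewrite (in_cutset_eps eps) negbK => /eqP.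
have key A : det A -> (forall h, tail eps h \in A -> head eps h \in A) ->
    f \in cutset A -> g \in cutset A.
  move=> detA clA fA; apply: contraT => gA.
  have PA : P A.
    rewrite /P (cutset_proper fA); apply/eqP/setP => h.
    by rewrite in_dir_from inE; apply/negP => /andP[/clA ->].
  have := minS _ PA; rewrite leqNgt => /negP[]; apply/proper_card/properP.
  split; last by exists g.
  apply/subsetP => h; apply: contraLR => /detA e.
  by rewrite (in_cutset_eps eps) e eqxx.
have [gtS ghS] : tail eps g \notin S /\ head eps g \in S.
  move: gS (nS g); rewrite (in_cutset_eps eps).
  by case: (tail eps g \in S); case: (head eps g \in S) => // _ /(_ isT).
have [ftS fhS] : tail eps f \notin S /\ head eps f \in S.
  move: (sub f fT) (nS f); rewrite (in_cutset_eps eps).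
  by case: (tail eps f \in S); case: (head eps f \in S) => // _ /(_ isT).
have keyI A : det A -> f \in cutset (S :&: A) -> g \in cutset (S :&: A).
  move=> detA; apply: key => h; first by move=> hS; rewrite !inE detS ?detA.
  rewrite !inE => /andP[tS tA]; rewrite (nS _ tS) -detA //.
  by rewrite (in_cutset_eps eps) tS (nS _ tS).
have keyU A : det A -> f \in cutset (S :|: A) -> g \in cutset (S :|: A).
  move=> detA; apply: key => h; first by move=> hS; rewrite !inE detS ?detA.
  rewrite !inE => /orP[/nS->//|tA]; case hS: (head eps h \in S) => //=.
  rewrite -detA //; apply: contraFN hS; rewrite (in_cutset_eps eps).
  by case tS: (_ \in S); [rewrite nS | case: (_ \in S)].
have detTC : det (~: T) by move=> h /detT; rewrite !inE => ->.
(* The ends of [g] lie on one side of [T], those of [f] on different sides, and both edges enter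
   [S]: one of the four sets is crossed by [f] and not by [g]. *)
move: gT fT (keyI _ detT) (keyU _ detT) (keyI _ detTC) (keyU _ detTC).
rewrite !(in_cutset_eps eps) !inE ghS fhS (negbTE gtS) (negbTE ftS) /=.
case: (tail eps g \in T); case: (head eps g \in T) => // _;
  case: (tail eps f \in T); case: (head eps f \in T) => //= _ h1 h2 h3 h4;
  by [exact: h1 | exact: h2 | exact: h3 | exact: h4].
Qed.
End Cuts.

(** * Outdegree sequences and Eulerian equivalence *)

Section Outdegrees.
Variable G : graph.
Local Notation V := (gV G).
Local Notation E := (gE G).
Local Notation src e := (gends e).1.
Local Notation tgt e := (gends e).2.
Implicit Types (S T : {set V}) (F : {set E}) (e f g : E) (eps : orientation G).
Implicit Types (d : {ffun V -> nat}).

(** The number of edges induced by [S], kept as a sum of indicators so that inequalities between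
    vertex sets can be checked edge by edge. *)
Definition nin_in F S : nat := \sum_(f in F) ((src f \in S) && (tgt f \in S)).
Definition nin S : nat := \sum_(f : E) ((src f \in S) && (tgt f \in S)).

Definition outdeg eps : {ffun V -> nat} := [ffun v => \sum_(f : E) (tail eps f == v)].

Definition add1 (x : V) d : {ffun V -> nat} := [ffun y => d y + (y == x)].
Definition sub1 (x : V) d : {ffun V -> nat} := [ffun y => d y - (y == x)].

Lemma add1K x d : sub1 x (add1 x d) = d.
Proof. by apply/ffunP => y; rewrite !ffunE addnK. Qed.

Lemma sub1K x d : 0 < d x -> add1 x (sub1 x d) = d.
Proof.
move=> dx; apply/ffunP => y; rewrite !ffunE.
by have [->|] := eqVneq y x; rewrite ?subnK ?subn0 ?addn0.
Qed.

Lemma sum_indic S x : \sum_(y in S) (y == x) = (x \in S) :> nat.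
Proof.
have [xS|xS] := boolP (x \in S).
  rewrite (bigD1 x) //= eqxx big1 ?addn0 // => y /andP[_ /negbTE->] //.
by rewrite big1 // => y yS; have [yx|//] := eqVneq y x; rewrite -yx yS in xS.
Qed.

Lemma sum_add1 S x d : \sum_(y in S) add1 x d y = \sum_(y in S) d y + (x \in S).
Proof. by rewrite -sum_indic -big_split; apply: eq_bigr => y _; rewrite ffunE. Qed.

Lemma sum_setUI S T (d : V -> nat) :
  \sum_(y in S :|: T) d y + \sum_(y in S :&: T) d y =
  \sum_(y in S) d y + \sum_(y in T) d y.
Proof.
have mk (A : {set V}) : \sum_(y in A) d y = \sum_y (y \in A) * d y.
  by rewrite big_mkcond; apply: eq_bigr => y _; case: (y \in A); rewrite ?mul1n.
rewrite !mk -!big_split; apply: eq_bigr => y _ /=.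
by rewrite !inE; case: (y \in S); case: (y \in T); rewrite ?mul1n ?addn0.
Qed.

Lemma nin_in_D1 F e S : e \in F ->
  nin_in F S = nin_in (F :\ e) S + ((src e \in S) && (tgt e \in S)).
Proof.
move=> eF; rewrite /nin_in (bigD1 e) //= addnC; congr (_ + _).
by apply: eq_bigl => f; rewrite !inE andbC.
Qed.

Lemma nin_in_setUI F S T :
  nin_in F S + nin_in F T <= nin_in F (S :|: T) + nin_in F (S :&: T).
Proof.
rewrite -!big_split; apply: leq_sum => f _ /=; rewrite !inE.
by case: (_ \in S); case: (_ \in T); case: (_ \in S); case: (_ \in T).
Qed.

(* Hakimi's theorem.  An edge [e] with ends [u], [v] can be charged to [u] unless
   some tight set contains [u] but not [v]; two opposite tight sets would violate
   the hypothesis on their union by supermodularity of [nin_in]. *)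
Lemma hakimi F d :
  (forall S, nin_in F S <= \sum_(y in S) d y) ->
  exists eps, forall v, \sum_(f in F) (tail eps f == v) <= d v.
Proof.
move: {2}#|F| (leqnn #|F|) => n; elim: n F d => [|n IH] F d leF Hd.
  exists [ffun => true] => v; rewrite big1 // => f.
  by move: leF; rewrite leqn0 cards_eq0 => /eqP->; rewrite inE.
have [->|/set0Pn[e eF]] := eqVneq F set0.
  by exists [ffun => true] => v; rewrite big1 // => f; rewrite inE.
(* Directing [e] by [b] costs its tail [x] one unit of [d]; the assumption is what the induction
   hypothesis needs for [F :\ e]. *)
have step b : let x := if b then src e else tgt e in
    [forall S : {set V}, nin_in (F :\ e) S + (x \in S) <= \sum_(y in S) d y] ->
    exists eps, forall v, \sum_(f in F) (tail eps f == v) <= d v.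
  move=> x /forallP Hx.
  have dx : 0 < d x.
    by move: (Hx [set x]); rewrite big_set1 set11 addn1; apply: leq_ltn_trans.
  have [||eps Heps] := IH (F :\ e) (sub1 x d).
  - by move: leF; rewrite (cardsD1 e) eF.
  - move=> S; have := Hx S; rewrite -{1}(sub1K dx) sum_add1; lia.
  exists [ffun f => if f == e then b else eps f] => v.
  rewrite (bigD1 e) //= {1}/tail ffunE eqxx -/x -(sub1K dx) ffunE addnC.
  rewrite (eq_sym v) leq_add2r; apply: leq_trans (Heps v).
  rewrite (eq_bigl (mem (F :\ e))) => [|f]; last by rewrite !inE andbC.
  apply: leq_sum => f; rewrite !inE /tail ffunE => /andP[/negbTE->] //.
pose chargeable x := [forall S : {set V}, nin_in (F :\ e) S + (x \in S) <= \sum_(y in S) d y].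
have [/(step true)//|/forallPn[S]] := boolP (chargeable (src e)).
have [/(step false)//|/forallPn[T]] := boolP (chargeable (tgt e)).
have := Hd S; have := Hd T; have := Hd (S :|: T); have := Hd (S :&: T).
have := sum_setUI S T d; have := nin_in_setUI (F :\ e) S T.
rewrite !(nin_in_D1 _ eF) !inE.
by case: (src e \in S); case: (src e \in T); case: (tgt e \in S); case: (tgt e \in T) => /=; lia.
Qed.

(** These are the outdegree sequences of strong orientations: the excess over [nin S] is the number
    of edges leaving [S]. *)
Definition strict d : bool :=
  (\sum_v d v == #|E|) &&
  [forall S : {set V}, proper_side S ==> (nin S < \sum_(y in S) d y)].

Lemma strictP d :
  reflect ((\sum_v d v = #|E|) /\
           forall S, proper_side S -> nin S < \sum_(y in S) d y) (strict d).
Proof.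
apply: (iffP andP) => -[/eqP h1 h2]; split => //.
  by move=> S; apply/implyP/(forallP h2 S).
by apply/forallP => S; apply/implyP/h2.
Qed.

Lemma sum_outdeg_in eps S :
  \sum_(y in S) outdeg eps y = \sum_(f : E) (tail eps f \in S).
Proof.
under eq_bigr do rewrite ffunE.
rewrite exchange_big; apply: eq_bigr => f _ /=.
by under eq_bigr do rewrite eq_sym; rewrite sum_indic.
Qed.

Lemma sum_outdeg eps : \sum_v outdeg eps v = #|E|.
Proof.
have := sum_outdeg_in eps setT; rewrite (eq_bigl predT) => [->|v]; last by rewrite inE.
by rewrite (eq_bigr (fun=> 1)) => [|f _]; rewrite ?sum1_card ?inE.
Qed.

(** An edge with its tail in [S] either stays inside [S] or leaves it. *)
Lemma sum_outdeg_dir eps S :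
  \sum_(y in S) outdeg eps y = nin S + #|dir_from eps S|.
Proof.
rewrite sum_outdeg_in -sum1_card [\sum_(f in dir_from _ _) _]big_mkcond -big_split.
apply: eq_bigr => f _; rewrite in_dir_from /tail /head.
by case: (eps f); case: (src f \in S); case: (tgt f \in S).
Qed.

Lemma strict_outdeg eps : strict (outdeg eps) = strong eps.
Proof.
rewrite /strict sum_outdeg eqxx; apply: eq_forallb => S.
by rewrite sum_outdeg_dir -[X in X < _]addn0 ltn_add2l card_gt0.
Qed.

(** Hakimi's theorem bounds the outdegrees by [d]; since both totals are [#|E|], all the bounds are
    attained. *)
Lemma strict_realized d : strict d -> exists eps, outdeg eps = d.
Proof.
case/strictP => tot Hd; case: (@hakimi setT d) => [S|eps Heps].
  have -> : nin_in setT S = nin S by apply: eq_bigl => f; rewrite inE.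
  have [/Hd/ltnW//|] := boolP (proper_side S).
  rewrite negb_and !negbK => /orP[]/eqP->.
    by rewrite /nin big1 // => f; rewrite !inE.
  rewrite [X in _ <= X](eq_bigl predT) => [|v]; last by rewrite inE.
  by rewrite tot -sum1_card; apply: leq_sum => f _; apply: leq_b1.
exists eps; have le v : outdeg eps v <= d v.
  by have := Heps v; rewrite ffunE (eq_bigl predT) // => f; rewrite inE.
have := @leqif_sum _ predT (fun v => outdeg eps v == d v) _ _ (fun v _ => conj (le v) erefl).
rewrite sum_outdeg tot => -[_]; rewrite eqxx => /esym/forallP h.
by apply/ffunP => v; apply/eqP/h.
Qed.

(** Edges with a common direction contribute equally to both outdegrees. On the others the tail
    under [eps2] is the head under [eps1], so equal outdegrees mean that the difference is
    balanced. *)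
Lemma eul_equivE eps1 eps2 : eul_equiv eps1 eps2 = (outdeg eps1 == outdeg eps2).
Proof.
have cardE (P Q : pred E) : #|[set f in [set f | P f] | Q f]| = \sum_(f | P f) Q f.
  rewrite -sum1_card big_mkcond [RHS]big_mkcond; apply: eq_bigr => f _.
  by rewrite !inE; case: (P f); case: (Q f).
have dec v : (outdeg eps1 v == outdeg eps2 v) =
  (#|[set e in [set e | eps1 e != eps2 e] | head eps1 e == v]| ==
   #|[set e in [set e | eps1 e != eps2 e] | tail eps1 e == v]|).
  rewrite !cardE !ffunE (bigID (fun f => eps1 f != eps2 f)) /=.
  rewrite [X in _ == X](bigID (fun f => eps1 f != eps2 f)) /=.
  rewrite [X in _ + X == _](eq_bigr (fun f => tail eps2 f == v : nat)); last first.
    by move=> f; rewrite negbK /tail => /eqP->.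
  rewrite eqn_add2r eq_sym; congr (_ == _); apply: eq_bigr => f.
  by rewrite /tail /head; case: (eps1 f); case: (eps2 f).
apply/forallP/eqP => [h|e v]; last by rewrite -dec e.
by apply/ffunP => v; apply/eqP; rewrite dec.
Qed.

(** A list without repetitions rather than a finite set, because [{ffun V -> nat}] is infinite in
    general. *)
Definition strict_seqs : seq {ffun V -> nat} :=
  undup [seq outdeg eps | eps <- enum (BO G)].

Lemma mem_strict_seqs d : gconnected G -> (d \in strict_seqs) = strict d.
Proof.
move=> conn; rewrite mem_undup; apply/mapP/idP => [[eps]|sd].
  by rewrite mem_enum BO_strong // -strict_outdeg => h ->.
have [eps de] := strict_realized sd; exists eps => //.
by rewrite mem_enum BO_strong // -strict_outdeg de.
Qed.

(** Maps that identify the same elements of [s] take equally many values; this turns the count of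
    equivalence classes into a count of outdegree sequences. *)
Lemma size_undup_map (X Y Z : eqType) (p : X -> Y) (q : X -> Z) (s : seq X) :
  {in s &, forall x y, (p x == p y) = (q x == q y)} ->
  size (undup (map p s)) = size (undup (map q s)).
Proof.
elim: s => //= x s IH h.
have -> : (p x \in map p s) = (q x \in map q s).
  by apply/mapP/mapP => -[y ys /eqP e]; exists y => //; apply/eqP;
    move: e; rewrite h // inE ?eqxx ?ys ?orbT.
have {}IH : size (undup (map p s)) = size (undup (map q s)).
  by apply: IH => a b sa sb; apply: h; rewrite inE ?sa ?sb orbT.
by case: ifP => _ //=; rewrite IH.
Qed.

Lemma alphaE : alpha G = size strict_seqs.
Proof.
rewrite /alpha /strict_seqs cardE.
set cl := fun eps1 : orientation G => [set eps2 in BO G | eul_equiv eps1 eps2].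
have -> : size (enum (cl @: BO G)) = size (undup (map cl (enum (BO G)))).
  apply/perm_size/uniq_perm; rewrite ?enum_uniq ?undup_uniq // => C.
  rewrite mem_enum mem_undup; apply/imsetP/mapP => -[x xB ->]; exists x => //;
    by rewrite mem_enum in xB *.
apply: size_undup_map => x y; rewrite !mem_enum => xB yB.
apply/eqP/eqP => [/setP/(_ y)|e].
  by rewrite !inE eul_equivE; move: yB; rewrite inE => ->; rewrite eul_equivE eqxx => /eqP.
by apply/setP => z; rewrite /cl !inE !eul_equivE e.
Qed.
End Outdegrees.

(** * Deletion of an edge; loops and bridges *)

(** Both minors have the edges other than [e], as a subtype; this splits off the term of [e]. *)
Lemma sum_sub (X : finType) (a : X) (F : X -> nat) :
  \sum_x F x = \sum_(x : {x | x != a}) F (val x) + F a.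
Proof.
rewrite (bigD1 a) //= addnC; congr (_ + _).
rewrite (reindex_omap (val : {x | x != a} -> X) insub); last first.
  by move=> x xa; rewrite insubT.
by apply: eq_bigl => -[x xa] /=; rewrite insubT /= eqxx xa.
Qed.

Lemma sum_setT (X : finType) (F : X -> nat) : \sum_(x in setT) F x = \sum_x F x.
Proof. by apply: eq_bigl => x; rewrite inE. Qed.

Section Deletion.
Variables (G : graph) (e : gE G).
Local Notation V := (gV G).
Local Notation E := (gE G).
Local Notation src e := (gends e).1.
Local Notation tgt e := (gends e).2.
Implicit Types (S : {set V}) (d : {ffun V -> nat}) (F : {set gE (del e)}).

Lemma card_del : #|E| = #|gE (del e)|.+1.
Proof. by rewrite -!sum1_card (sum_sub e) addn1. Qed.

Lemma nin_del S : nin S = @nin (del e) S + ((src e \in S) && (tgt e \in S)).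
Proof. by rewrite /nin (sum_sub e). Qed.

Lemma mem_val_imset F (f : gE (del e)) : (val f \in val @: F) = (f \in F).
Proof. by rewrite mem_imset //; apply: val_inj. Qed.

Lemma notin_val_imset F : e \notin val @: F.
Proof. by apply/imsetP => -[[f fe] _ /= ef]; rewrite -ef eqxx in fe. Qed.

Lemma connectsAll_del F : @connectsAll (del e) F = connectsAll (val @: F).
Proof.
apply/connectsAllP/connectsAllP => h S /h[f fF fS].
  by exists (val f); rewrite ?mem_val_imset //; rewrite !inE in fS *.
by case/imsetP: fF fS => f' f'F ->; rewrite inE => f'S; exists f'; rewrite ?inE.
Qed.

Lemma val_imsetT : val @: [set: gE (del e)] = setT :\ e.
Proof.
apply/setP => f; rewrite !inE andbT; apply/imsetP/idP => [[f' _ ->]|fe].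
  exact: (valP f').
by exists (exist _ f fe); rewrite ?inE.
Qed.

Lemma gconnected_del : gconnected G -> is_loop e || ~~ is_bridge e -> gconnected (del e).
Proof.
move=> conn h; rewrite /gconnected connectsAll_del val_imsetT.
apply/connectsAllP => S pS; have [f fS] := gconnected_cut conn pS.
have [fe|fe] := eqVneq f e; last by exists f; rewrite // !inE fe.
rewrite fe in fS; case/orP: h => [/(@loop_cutset _ _ S)/negP//|h].
by have [g ge gS] := nonbridge_cutset h fS; exists g; rewrite // !inE ge.
Qed.

Lemma strict_gt0 d : strict d -> 0 < d (src e).
Proof.
case/strictP => tot h.
have -> : d (src e) = \sum_(y in [set src e]) d y by rewrite big_set1.
have [/h|] := boolP (proper_side [set src e]); first exact: leq_ltn_trans.
rewrite negb_and !negbK => /orP[/eqP/setP/(_ (src e))|/eqP->]; first by rewrite !inE eqxx.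
(* Here [src e] is the only vertex, and its value is the number of edges, positive because of
   [e]. *)
by rewrite sum_setT tot card_del.
Qed.

(** The bound for [S] grows only when both ends of [e] lie in [S], and then the sum grows as
    well. *)
Lemma strict_del_add1 x d : (x == src e) || (x == tgt e) ->
  @strict (del e) d -> strict (add1 x d).
Proof.
move=> xe /strictP[tot h]; apply/strictP; split.
  have := sum_add1 setT x d; rewrite !sum_setT in_setT addn1 card_del => ->.
  by rewrite tot.
move=> S /(h S); rewrite nin_del sum_add1.
by case/orP: xe => /eqP->; case: (src e \in S); case: (tgt e \in S) => /=; lia.
Qed.

(** The condition on [sub1 x d] is stated with the unit moved to the left, free of truncated
    subtraction. *)
Lemma strict_sub1_del x d : 0 < d x -> strict d ->
  (forall S, proper_side S -> @nin (del e) S + (x \in S) < \sum_(y in S) d y) ->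
  @strict (del e) (sub1 x d).
Proof.
move=> dx /strictP[tot _] h; apply/strictP; split.
  have := sum_add1 setT x (sub1 x d); rewrite sub1K // in_setT addn1.
  by rewrite !sum_setT tot card_del => -[<-].
by move=> S /h; rewrite -{1}(sub1K dx) sum_add1; rewrite ltn_add2r.
Qed.

(** A loop adds one to the outdegree of its vertex in either direction, so [add1 (src e)] is a
    bijection between the sequences. *)
Lemma alpha_loop : gconnected G -> is_loop e -> alpha G = alpha (del e).
Proof.
move=> conn lp; have conn' : gconnected (del e) by apply: gconnected_del; rewrite ?lp.
rewrite !alphaE -(size_map (add1 (src e)) (strict_seqs (del e))).
apply/perm_size/uniq_perm; rewrite ?undup_uniq //.
  by rewrite map_inj_uniq ?undup_uniq //; apply: can_inj (add1K _).
move=> d; rewrite mem_strict_seqs //; apply/idP/mapP => [sd|[d']]; last first.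
  move=> d'S ->; apply: strict_del_add1; rewrite ?eqxx //.
  by rewrite -mem_strict_seqs.
have du := strict_gt0 sd; exists (sub1 (src e) d); last by rewrite sub1K.
rewrite -[_ \in _]/(_ \in strict_seqs (del e)) mem_strict_seqs //.
apply: strict_sub1_del => // S pS.
by case/strictP: sd => _ /(_ S pS); rewrite nin_del -(eqP lp) andbb.
Qed.

(** The bridge would have to leave both sides of its cut, so [BO G] is empty. *)
Lemma alpha_bridge : gconnected G -> is_bridge e -> alpha G = 0.
Proof.
move=> conn /bridge_cutset[S [sS tS cS]].
have pS := proper_side_sep sS tS.
rewrite /alpha (_ : BO G = set0) ?imset0 ?cards0 //; apply/setP => eps.
rewrite [RHS]inE BO_strong //; apply/negP => /forallP str.
have := str S; have := str (~: S); rewrite proper_sideC pS /=.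
move=> /set0Pn[f fS] /set0Pn[g gS].
have fe : f = e by apply/set1P; rewrite -cS -cutsetC; case/setIdP: fS.
have ge : g = e by apply/set1P; rewrite -cS; case/setIdP: gS.
by move: fS gS; rewrite fe ge !in_dir_from inE => /andP[/negbTE->].
Qed.
End Deletion.

(** * Contraction of an edge and the recursion for [alpha] *)

Section Contraction.
Variables (G : graph) (e : gE G) (H : (gends e).1 != (gends e).2).
Local Notation V := (gV G).
Local Notation E := (gE G).
Local Notation G' := (contr H).
Local Notation u := (gends e).1.
Local Notation v := (gends e).2.
Local Notation vmap := (contr_vmap H).
Implicit Types (S : {set V}) (W : {set gV G'}) (d : {ffun V -> nat}) (F : {set gE G'}).

(** Vertex sets of the contraction correspond in this way to the vertex sets of [G] that do not
    separate [u] from [v]. *)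
Definition pre W : {set V} := [set x | vmap x \in W].

Lemma vmap_val (w : gV G') : vmap (val w) = w.
Proof. by apply: val_inj => /=; rewrite (negbTE (valP w)). Qed.

Lemma vmap_tgt : vmap v = vmap u.
Proof. by apply: val_inj => /=; rewrite eqxx (negbTE H). Qed.

Lemma vmap_eq x y : (vmap x == vmap y) =
  (x == y) || ((x \in [set u; v]) && (y \in [set u; v])).
Proof.
rewrite -val_eqE /= !inE.
have [->|xv] := eqVneq x v; have [->|yv] := eqVneq y v; rewrite ?eqxx ?orbT //=.
- by rewrite orbF eq_sym.
- by rewrite orbF andbT (negbTE xv).
- by rewrite !orbF; case: (eqVneq x y) => [//|nxy] /=; case: eqP => // xu;
    rewrite -xu eq_sym (negbTE nxy).
Qed.

Lemma pre_ends W : (u \in pre W) = (v \in pre W).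
Proof. by rewrite !inE vmap_tgt. Qed.

Lemma pre_surj S : (u \in S) = (v \in S) -> exists W, S = pre W.
Proof.
move=> h; exists [set w | val w \in S]; apply/setP => x; rewrite !inE /=.
by case: eqP => [->|//].
Qed.

Lemma proper_side_pre W : proper_side (pre W) = proper_side W.
Proof.
apply/idP/idP => /proper_side_ex[x [y []]].
  by rewrite !inE; apply: proper_side_sep.
by rewrite -{1}(vmap_val x) -{1}(vmap_val y) => xS yS;
   apply: (@proper_side_sep _ _ (val x) (val y)); rewrite inE.
Qed.

Lemma cutset_pre W (f : gE G') : (val f \in cutset (pre W)) = (f \in cutset W).
Proof. by rewrite !inE. Qed.

Lemma notin_cutset_pre W : e \notin cutset (pre W).
Proof. by rewrite inE pre_ends eqxx. Qed.

(** The cuts of the contraction are the cuts of [G] avoiding [e]; every other cut is met by [e]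
    itself. *)
Lemma connectsAll_contr F : connectsAll F = connectsAll (e |: val @: F).
Proof.
apply/connectsAllP/connectsAllP => h S pS; last first.
  have [|f] := h (pre S); first by rewrite proper_side_pre.
  rewrite !inE => /predU1P[->|/imsetP[f' f'F ->]].
    by rewrite vmap_tgt eqxx.
  by exists f'; rewrite ?inE.
have [uv|nuv] := eqVneq (u \in S) (v \in S); last by exists e; rewrite !inE ?eqxx.
have [W eS] := pre_surj uv; rewrite eS proper_side_pre in pS *.
have [f fF fS] := h _ pS; exists (val f); rewrite ?cutset_pre // !inE.
by rewrite (mem_val_imset (e := e)) fF orbT.
Qed.

Lemma gconnected_contr : gconnected G -> gconnected G'.
Proof.
rewrite /gconnected connectsAll_contr; apply: connectsAll_sub.
by rewrite (val_imsetT e) setD1K.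
Qed.

Lemma nin_contr W : nin (pre W) = nin W + (vmap u \in W).
Proof.
rewrite /nin (sum_sub e) !inE vmap_tgt andbb; congr (_ + _).
by apply: eq_bigr => f _; rewrite !inE.
Qed.

(** The effect of contracting [e] on outdegrees: the values at its ends are added, and the unit that
    [e] contributes to one of them is removed. *)
Definition merge d : {ffun gV G' -> nat} :=
  [ffun w => \sum_(x | vmap x == w) d x - (w == vmap u)].

Lemma sum_fiber d x : x \notin [set u; v] -> \sum_(y | vmap y == vmap x) d y = d x.
Proof.
move=> xuv; rewrite (big_pred1 x) // => y.
by rewrite vmap_eq (negbTE xuv) andbF orbF.
Qed.

Lemma sum_fiber_end d : \sum_(y | vmap y == vmap u) d y = d u + d v.
Proof.
rewrite (bigD1 u) //= (big_pred1 v) // => y.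
rewrite vmap_eq !inE eqxx andbT /=.
by have [->|] := eqVneq y u; rewrite ?(negbTE H) //= andbT.
Qed.

(** Positivity of [d u] makes the truncated subtraction in [merge] exact. *)
Lemma sum_merge d W : 0 < d u ->
  \sum_(w in W) merge d w + (vmap u \in W) = \sum_(x in pre W) d x.
Proof.
move=> du; rewrite -(sum_indic W) -big_split /=.
rewrite [RHS](partition_big vmap (mem W)) => [|x] /=; last by rewrite inE.
apply: eq_bigr => w wS; rewrite ffunE subnK.
  by apply: eq_bigl => x; rewrite inE; case: eqP => [->|]; rewrite ?wS ?andbF.
have [->|//] := eqVneq w (vmap u); rewrite sum_fiber_end; lia.
Qed.

Lemma strict_merge d : strict d -> strict (merge d).
Proof.
move=> sd; have du := strict_gt0 e sd; case/strictP: sd => tot h.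
apply/strictP; split.
  have := sum_merge setT du; have -> : pre setT = setT by apply/setP => x; rewrite !inE.
  by rewrite !sum_setT tot (card_del e) in_setT addn1 => -[].
move=> W pS; have := h (pre W); rewrite proper_side_pre pS => /(_ isT).
by rewrite nin_contr -sum_merge // ltn_add2r.
Qed.

Lemma merge_off d1 d2 x : merge d1 = merge d2 -> x \notin [set u; v] -> d1 x = d2 x.
Proof.
move=> /ffunP/(_ (vmap x)) + xuv; rewrite !ffunE !sum_fiber //.
suff /negbTE-> : vmap x != vmap u by rewrite !subn0.
rewrite vmap_eq (negbTE xuv) orbF; apply: contraNneq xuv => ->.
by rewrite !inE eqxx.
Qed.

(** [merge] fixes the values off [u] and [v] and the sum of those two, so the coordinate at [u]
    determines the rest. *)
Lemma merge_inj d1 d2 : 0 < d1 u -> 0 < d2 u -> merge d1 = merge d2 ->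
  d1 u = d2 u -> d1 = d2.
Proof.
move=> h1 h2 em eu; apply/ffunP => x.
have [xuv|] := boolP (x \in [set u; v]); last exact: merge_off.
have := congr1 (fun m : {ffun _} => m (vmap u)) em; rewrite !ffunE !sum_fiber_end eqxx => ev.
by move: xuv; rewrite !inE => /orP[]/eqP->; lia.
Qed.

Lemma merge_shift d : 0 < d u -> merge (add1 v (sub1 u d)) = merge d.
Proof.
move=> du; apply/ffunP => w; rewrite !ffunE; congr (_ - _).
rewrite -(vmap_val w); set x := val w.
have [xu|xu] := eqVneq x u.
  rewrite xu !sum_fiber_end !ffunE !eqxx (negbTE H) eq_sym (negbTE H); lia.
have xv : x != v := valP w.
have xuv : x \notin [set u; v] by rewrite !inE negb_or xu.
by rewrite !sum_fiber // !ffunE (negbTE xu) (negbTE xv) subn0 addn0.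
Qed.

(* An orientation of [contr H] lifts to [G] up to the direction of [e].  If both
   directions fail, the two sets [S] and [T] without outgoing edge are complementary,
   and then [e] is a bridge. *)
Lemma strict_merge_surj (d' : {ffun gV G' -> nat}) : ~~ is_bridge e -> strict d' ->
  exists2 d, strict d & merge d = d'.
Proof.
move=> nbr sd'; have [eps' de] := strict_realized sd'.
have str' : strong eps' by rewrite -strict_outdeg de.
pose eps b : orientation G :=
  [ffun f => if insub f is Some f' then eps' f' else b].
have epsV b (f : gE G') : eps b (val f) = eps' f by rewrite ffunE valK.
have epsE b : eps b e = b by rewrite ffunE insubF ?eqxx.
have dlift b : merge (outdeg (eps b)) = d'.
  apply/ffunP => w; rewrite -de !ffunE.
  have -> : \sum_(x | vmap x == w) outdeg (eps b) x =
            \sum_f (vmap (tail (eps b) f) == w).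
    under eq_bigr do rewrite ffunE.
    rewrite exchange_big; apply: eq_bigr => f _ /=.
    have [<-|nw] := eqVneq (vmap _) w.
      rewrite (bigD1 (tail (eps b) f)) //= eqxx big1 // => x /andP[_ /negbTE].
      by rewrite eq_sym => ->.
    rewrite big1 // => x /eqP xw; case: eqP => // tx.
    by rewrite tx xw eqxx in nw.
  rewrite (sum_sub e) {2}/tail epsE.
  have -> : vmap (if b then u else v) = vmap u by case: b; rewrite ?vmap_tgt.
  rewrite eq_sym addnK; apply: eq_bigr => f _.
  by rewrite /tail epsV; case: (eps' f).
have [b sb] : exists b, strong (eps b); last first.
  by exists (outdeg (eps b)); rewrite ?strict_outdeg.
(* A set that does not separate [u] from [v] and is left by no edge other than [e] comes from the
   contraction, where strength of [eps'] excludes proper ones. *)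
have cl S :
    (forall f : gE G', tail (eps true) (val f) \in S -> head (eps true) (val f) \in S) ->
    (u \in S) = (v \in S) -> ~~ proper_side S.
  move=> clS uv; have [W eS] := pre_surj uv; apply/negP => pS.
  rewrite eS proper_side_pre in pS; have := forallP str' W; rewrite pS.
  case/set0Pn => f; rewrite in_dir_from => /andP[tS hS].
  have := clS f; rewrite eS /tail /head epsV !inE.
  move: tS hS; rewrite /tail /head.
  by case: (eps' f) => /= tS /negbTE hS /(_ tS); rewrite hS.
have [|/forallPn[S]] := boolP (strong (eps true)); first by exists true.
have [|/forallPn[T]] := boolP (strong (eps false)); first by exists false.
rewrite !negb_imply !andbT => /andP[pT /eqP/setP dT] /andP[pS /eqP/setP dS].
exfalso.
have tb b (f : gE G') : tail (eps b) (val f) = tail (eps true) (val f) by rewrite /tail !epsV.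
have hb b (f : gE G') : head (eps b) (val f) = head (eps true) (val f) by rewrite /head !epsV.
have clT (f : gE G') : (tail (eps true) (val f) \in T) -> (head (eps true) (val f) \in T).
  have := dT (val f); rewrite in_dir_from tb hb inE => /negbT.
  by rewrite negb_and negbK => /orP[/negP|].
have clS (f : gE G') : (tail (eps true) (val f) \in S) -> (head (eps true) (val f) \in S).
  have := dS (val f); rewrite in_dir_from inE => /negbT.
  by rewrite negb_and negbK => /orP[/negP|].
(* Under [eps true] the edge [e] runs from [u] to [v] and does not leave [S]; by [cl] its ends are
   separated, so only [v] lies in [S]. For [T] the roles are exchanged. *)
have uvS : (v \in S) /\ (u \notin S).
  have := cl _ clS; have := dS e; rewrite in_dir_from /tail /head epsE inE pS.
  by case: (u \in S); case: (v \in S) => //= _ /(_ erefl).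
have uvT : (u \in T) /\ (v \notin T).
  have := cl _ clT; have := dT e; rewrite in_dir_from /tail /head epsE inE pT.
  by case: (u \in T); case: (v \in T) => //= _ /(_ erefl).
case: uvS uvT => vS uS [uT vT].
have : ~~ proper_side (S :&: T).
  apply: cl; last by rewrite !inE (negbTE uS) (negbTE vT) andbF.
  by move=> f; rewrite !inE => /andP[/clS-> /clT->].
have : ~~ proper_side (S :|: T).
  apply: cl; last by rewrite !inE vS uT orbT.
  by move=> f; rewrite !inE => /orP[/clS->|/clT->]; rewrite ?orbT.
rewrite !negb_and !negbK => /orP[/eqP/setP/(_ u)|/eqP/setP ST]; first by rewrite !inE uT orbT.
case/orP => [/eqP/setP ST0|/eqP/setP/(_ v)]; last by rewrite !inE (negbTE vT) andbF.
(* Now [T] is the complement of [S], and no edge but [e] leaves either of them, which a second edge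
   [g] across [S] contradicts. *)
have eS : e \in cutset S by rewrite inE vS (negbTE uS).
have [g ge gS] := nonbridge_cutset nbr eS.
have := clS (exist _ g ge); have := clT (exist _ g ge); rewrite /=.
move: gS; rewrite (in_cutset_eps (eps true)).
have := ST (tail (eps true) g); have := ST (head (eps true) g).
have := ST0 (tail (eps true) g); have := ST0 (head (eps true) g).
rewrite !inE; case: (tail (eps true) g \in S); case: (tail (eps true) g \in T) => //.
  by case: (head (eps true) g \in S) => // _ _ _ _ _ _ /(_ isT).
by case: (head (eps true) g \in S); case: (head (eps true) g \in T) => // _ _ _ _ _ /(_ isT).
Qed.

Lemma alpha_del_contr : gconnected G -> ~~ is_bridge e ->
  alpha G = alpha (del e) + alpha G'.
Proof.
move=> conn nbr.
have connD : gconnected (del e) by apply: gconnected_del; rewrite ?nbr ?orbT.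
have connC := gconnected_contr conn.
(* [A] selects the image of [add1 u], which gives the first summand; the sequences outside [A] are
   matched with those of the contraction by [merge]. *)
pose A d := @strict (del e) (sub1 u d).
rewrite !alphaE -(count_predC A) -!size_filter; congr (_ + _).
  rewrite -(size_map (add1 u) (strict_seqs (del e))).
  apply/perm_size/uniq_perm; rewrite ?filter_uniq ?undup_uniq //.
    by rewrite map_inj_uniq ?undup_uniq //; apply: can_inj (add1K _).
  move=> d; rewrite mem_filter mem_strict_seqs //; apply/andP/mapP => [[Ad sd]|[d']].
    exists (sub1 u d); last by rewrite sub1K // strict_gt0.
    by rewrite -[_ \in _]/(_ \in strict_seqs (del e)) mem_strict_seqs.
  move=> d'S ->; have sd' : @strict (del e) d' by rewrite -mem_strict_seqs.
  by split; [rewrite /A add1K | apply: (strict_del_add1 _ sd'); rewrite eqxx].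
rewrite -(size_map merge).
(* In a fibre of [merge] only the least value at [u] can escape [A]. Giving up a unit at [u] matters
   for the sets [S] containing [u] but not [v]; there [d1] and [d2] differ only at [u], so the sum
   of [d2] has room. *)
have mono d1 d2 : strict d1 -> strict d2 -> merge d1 = merge d2 -> d1 u < d2 u -> A d2.
  move=> sd1 sd2 em lt; have g1 := strict_gt0 e sd1; have g2 := strict_gt0 e sd2.
  apply: strict_sub1_del => // S pS.
  have := nin_del e S; case/strictP: sd2 => _ /(_ S pS).
  case/strictP: sd1 => _ /(_ S pS).
  case uS: (u \in S); case vS: (v \in S) => /=; try lia.
  suff : \sum_(y in S) d1 y < \sum_(y in S) d2 y by lia.
  rewrite (bigD1 u) //= [X in _ < X](bigD1 u) //=.
  rewrite (eq_bigr d2) ?ltn_add2r // => y /andP[yS yu]; apply: (merge_off em).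
  by rewrite !inE negb_or yu; apply: contraTneq yS => ->; rewrite vS.
apply/perm_size/uniq_perm; rewrite ?undup_uniq //.
  rewrite map_inj_in_uniq ?filter_uniq ?undup_uniq // => d1 d2.
  rewrite !mem_filter !mem_strict_seqs // => /andP[/= nA1 sd1] /andP[/= nA2 sd2] em.
  apply: merge_inj => //; try exact: strict_gt0.
  have [lt|lt|//] := ltngtP (d1 u) (d2 u).
    by rewrite (mono _ _ sd1 sd2 em lt) in nA2.
  by rewrite (mono _ _ sd2 sd1 (esym em) lt) in nA1.
move=> d'; rewrite mem_strict_seqs //; apply/mapP/idP => [[d]|sd'].
  by rewrite mem_filter mem_strict_seqs // => /andP[_ sd] ->; apply: strict_merge.
have [d sd <-] := strict_merge_surj nbr sd'.
(* Descent in the fibre: while [A d] holds, moving a unit from [u] to [v] keeps [d] strict and its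
   image fixed. It stops because strictness keeps [d u] positive. *)
move: {2}(d u) (leqnn (d u)) sd => n; elim: n d => [|n IH] d dn sd.
  by have := strict_gt0 e sd; lia.
have [Ad|nAd] := boolP (A d); last by exists d; rewrite // mem_filter /= nAd mem_strict_seqs.
have du := strict_gt0 e sd.
rewrite -(merge_shift du); apply: IH; last by apply: (strict_del_add1 _ Ad); rewrite eqxx orbT.
by rewrite !ffunE eqxx (negbTE H); lia.
Qed.
End Contraction.

(** * Spanning trees, exchange and internal activity *)

Section Trees.
Variable G : graph.
Local Notation V := (gV G).
Local Notation E := (gE G).
Implicit Types (S : {set V}) (T F : {set E}) (e f g : E).

(** Some cut avoids the disconnected set [T :\ f]; as [T] meets it, it does so in [f] alone.
    Minimality of [T] is thus certified by a cut for each of its edges. *)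
Lemma spanning_treeP T :
  reflect (connectsAll T /\ forall f, f \in T ->
             exists2 S, f \in cutset S & forall g, g \in T -> g \in cutset S -> g = f)
          (spanning_tree T).
Proof.
apply: (iffP andP) => -[cT h]; split => //.
  move=> f fT; case/connectsAllPn: (forall_inP h _ fT) => S pS nS.
  have only g : g \in T -> g \in cutset S -> g = f.
    move=> gT; apply: contraTeq => gf; apply: nS; by rewrite !inE gf.
  exists S => //; case/connectsAllP/(_ S pS): cT => g gT gS.
  by rewrite -(only g gT gS).
apply/forall_inP => f /h[S fS only]; apply/connectsAllPn; exists S.
  exact: cutset_proper fS.
by move=> g; rewrite in_setD1 => /andP[gf gT]; apply: contra gf => gS; apply/eqP/only.
Qed.

Lemma tree_loop T e : spanning_tree T -> is_loop e -> e \notin T.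
Proof.
case/spanning_treeP => _ h lp; apply/negP => /h[S eS _].
by move: (loop_cutset S lp); rewrite eS.
Qed.

Lemma tree_bridge T e S : spanning_tree T -> cutset S = [set e] -> e \in T.
Proof.
case/spanning_treeP => /connectsAllP cT _ cS.
have eS : e \in cutset S by rewrite cS set11.
by have [f fT] := cT S (cutset_proper eS); rewrite cS => /set1P <-.
Qed.

(* Basis exchange: the cut of [T] at [e] contains a second edge [g], and every cut
   certifying minimality of [T] is corrected by a symmetric difference with it. *)
Lemma tree_exchange T e : spanning_tree T -> e \in T -> ~~ is_bridge e ->
  exists2 g, g != e & spanning_tree ((T :\ e) :|: [set g]).
Proof.
case/spanning_treeP => cT mT eT nbr; have [S eS onlyS] := mT e eT.
have [g ge gS] := nonbridge_cutset nbr eS.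
have gT : g \notin T by apply: contra ge => gT; apply/eqP/onlyS.
have in_exch h : (h \in (T :\ e) :|: [set g]) = (h != e) && (h \in T) || (h == g).
  by rewrite !inE.
exists g => //; apply/spanning_treeP; split.
  apply/connectsAllP => S1 pS1.
  case/connectsAllP/(_ S1 pS1): (cT) => f fT fS1.
  have [fe|fe] := eqVneq f e; last by exists f; rewrite // !inE fe fT.
  rewrite {f}fe in fT fS1.
  have [gS1|gS1] := boolP (g \in cutset S1); first by exists g; rewrite // !inE eqxx orbT.
  (* Both cuts contain [e], which cancels in their sum. An edge of [T] in the sum is thus not [e],
     and since [T] meets the cut of [S] only in [e], that edge crosses [S1]. *)
  have gD : g \in cutset (symd S S1) by rewrite cutset_symd gS (negbTE gS1).
  case/connectsAllP/(_ _ (cutset_proper gD)): cT => h hT; rewrite cutset_symd.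
  have [->|he] := eqVneq h e; first by rewrite eS fS1.
  have [/(onlyS _ hT) hE|_ /= hS1] := boolP (h \in cutset S).
    by rewrite hE eqxx in he.
  by exists h; rewrite // !inE he hT.
move=> f; rewrite in_exch => /orP[/andP[fe fT]|/eqP->]; last first.
  exists S => // h; rewrite in_exch => /orP[/andP[he hT]|/eqP//] hS.
  by case/eqP: he; apply: onlyS.
have [Sf fSf onlyf] := mT f fT.
have [gSf|gSf] := boolP (g \in cutset Sf); last first.
  exists Sf => // h; rewrite in_exch => /orP[/andP[_ hT]|/eqP->]; first exact: onlyf.
  by rewrite (negbTE gSf).
have fS : f \notin cutset S by apply: contra fe => fS; apply/eqP/onlyS.
exists (symd S Sf); first by rewrite cutset_symd fSf (negbTE fS).
move=> h; rewrite in_exch => /orP[/andP[he hT]|/eqP->]; last first.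
  by rewrite cutset_symd gS gSf.
rewrite cutset_symd.
have [hS|_ /=] := boolP (h \in cutset S); first by rewrite (onlyS h) ?eqxx in he.
exact: onlyf.
Qed.

Definition inactive_tree (r : E -> nat) T :=
  spanning_tree T && [forall f in T, ~~ int_active r T f].

Lemma trees_no_int_activeE (r : E -> nat) :
  trees_no_int_active r = #|[set T | inactive_tree r T]|.
Proof. by []. Qed.

Lemma int_activeP r T f : f \in T ->
  reflect (forall g, spanning_tree ((T :\ f) :|: [set g]) -> r f <= r g)
          (int_active r T f).
Proof.
move=> fT; rewrite /int_active fT.
by apply: (iffP forall_inP) => h g gT; apply: h; rewrite inE in gT *.
Qed.

(** A bridge lies in every spanning tree and can be exchanged only for itself, so it is internally
    active. *)
Lemma inactive_tree_bridge r e T : is_bridge e -> ~~ inactive_tree r T.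
Proof.
case/bridge_cutset => S [_ _ cS]; apply/negP => /andP[tT /forall_inP act].
have eT := tree_bridge tT cS; case/negP: (act e eT); apply/int_activeP => // g tg.
by move: (tree_bridge tg cS); rewrite !inE eqxx => /eqP->.
Qed.
End Trees.

(** * Deletion and contraction of the largest edge in spanning trees *)

Section TreeMinors.
Variables (G : graph) (e : gE G) (r : gE G -> nat).
Hypothesis r_inj : injective r.
Hypothesis r_max : forall f, r f <= r e.
Local Notation V := (gV G).
Local Notation E := (gE G).
Local Notation E' := {f : gE G | f != e}.
Local Notation inj F := ((val : E' -> E) @: F).
Local Notation r' := (fun f : E' => r (val f)).
Implicit Types (F : {set E'}) (T : {set E}).

Lemma inj_D1 F (f : E') : inj (F :\ f) = inj F :\ val f.
Proof.
apply/setP => g; rewrite !inE; apply/imsetP/andP => [[h]|[gf /imsetP[h hF eg]]].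
  by rewrite !inE => /andP[hf hF] ->; rewrite (inj_eq val_inj) hf imset_f.
by exists h; rewrite // !inE hF andbT; apply: contraNneq gf => <-; rewrite eg.
Qed.

Lemma inj_exchange F (f g : E') :
  inj ((F :\ f) :|: [set g]) = (inj F :\ val f) :|: [set val g].
Proof. by rewrite imsetU imset_set1 inj_D1. Qed.

Lemma notin_inj F : e \notin inj F.
Proof. exact: notin_val_imset. Qed.

Lemma in_inj F (f : E') : (val f \in inj F) = (f \in F).
Proof. exact: mem_val_imset. Qed.

Lemma inj_surj T : e \notin T -> T = inj [set f : E' | val f \in T].
Proof.
move=> eT; apply/setP => f; have [->|fe] := eqVneq f e.
  by rewrite (negbTE eT) (negbTE (notin_inj _)).
by rewrite -[f]/(val (exist (fun f => f != e) f fe)) in_inj inE.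
Qed.

Lemma spanning_tree_del F : @spanning_tree (del e) F = spanning_tree (inj F).
Proof.
rewrite /spanning_tree connectsAll_del; congr (_ && _).
apply/forall_inP/forall_inP => h f; last first.
  by move=> fF; rewrite connectsAll_del inj_D1; apply: h; rewrite in_inj.
by case/imsetP => f' f'F ->; rewrite -inj_D1 -connectsAll_del; apply: h.
Qed.

(** Exchanging [f] for [e] is an extra test in [G], always passed because [e] has the largest
    rank. *)
Lemma inactive_tree_del F : @inactive_tree (del e) r' F = inactive_tree r (inj F).
Proof.
rewrite /inactive_tree spanning_tree_del; congr (_ && _).
have act (f : E') : f \in F -> @int_active (del e) r' F f = int_active r (inj F) (val f).
  move=> fF; have vf : val f \in inj F by rewrite in_inj.
  apply/(@int_activeP (del e) _ _ _ fF)/(int_activeP _ vf) => h g.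
    have [->|ge] := eqVneq g e; first by move=> _; apply: r_max.
    rewrite -[g]/(val (exist (fun f => f != e) g ge)) -inj_exchange -spanning_tree_del.
    exact: h.
  by rewrite spanning_tree_del inj_exchange => /h.
apply/forall_inP/forall_inP => h f; last by move=> fF; rewrite act // h // in_inj.
by case/imsetP => f' f'F ->; rewrite -act // h.
Qed.

Section Contract.
Hypothesis H : (gends e).1 != (gends e).2.

(* If a spanning tree [F] of the contraction already connected [G], take a cut
   separating the ends of [e] that meets [F] as little as possible: adding the cut
   of [contr H] that meets [F] in a single one of these edges reduces it further. *)
Lemma contr_tree_disconnected F :
  @spanning_tree (contr H) F -> ~~ connectsAll (inj F).
Proof.
case/(@spanning_treeP (contr H)) => _ mF; apply/negP => cF.
have e1 : e \in cutset [set (gends e).1] by rewrite !inE eqxx [_.2 == _]eq_sym (negbTE H).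
pose P (S : {set V}) := e \in cutset S.
case: (@arg_minnP _ [set (gends e).1] P (fun S => #|cutset S :&: inj F|) e1) => S eS minS.
case/connectsAllP/(_ S (cutset_proper eS)): cF => _ /imsetP[f fF ->] fS.
have [W fW onlyW] := mF f fF.
have eD : e \in cutset (symd S (pre W)).
  by rewrite cutset_symd (eS : e \in cutset S) (negbTE (notin_cutset_pre W)).
have := minS _ eD; rewrite leqNgt => /negP[]; apply/proper_card/properP; split.
  apply/subsetP => g0 /setIP[gD /imsetP[g gF eg]]; move: gD; rewrite {}eg => gD.
  apply/setIP; split; last by rewrite in_inj.
  move: gD; rewrite cutset_symd cutset_pre.
  by have [/(onlyW g gF)->|_] := boolP (g \in cutset W); rewrite ?fS ?addbF.
exists (val f); first by rewrite inE fS in_inj.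
by rewrite inE cutset_symd fS cutset_pre fW.
Qed.

(** Connectivity transfers for [F] and its subsets; the one new condition, that [e] cannot be
    dropped, is [contr_tree_disconnected]. *)
Lemma spanning_tree_contr F : @spanning_tree (contr H) F = spanning_tree (e |: inj F).
Proof.
have D1 (f : E') : (e |: inj F) :\ val f = e |: inj (F :\ f).
  rewrite inj_D1; apply/setP => g; rewrite !inE.
  by have [->|] := eqVneq g e; rewrite ?andbF // andbT eq_sym (valP f).
apply/idP/idP => [tF|/andP[cF /forall_inP mF]].
  apply/andP; split; first by case/andP: tF => cF _; rewrite -connectsAll_contr.
  apply/forall_inP => f; rewrite in_setU1 => /predU1P[->|/imsetP[f' f'F ->]].
    by rewrite setU1K ?notin_inj // contr_tree_disconnected.
  by rewrite D1 -connectsAll_contr; case/andP: tF => _ /forall_inP; apply.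
apply/andP; split; first by rewrite connectsAll_contr.
by apply/forall_inP => f fF; rewrite connectsAll_contr -D1 mF // in_setU1 in_inj fF orbT.
Qed.

(** The other edges keep their activity as under deletion. The edge [e] itself is inactive: not
    being a bridge, it can be exchanged for another edge, of strictly smaller rank. *)
Lemma inactive_tree_contr F : ~~ is_bridge e ->
  @inactive_tree (contr H) r' F = inactive_tree r (e |: inj F).
Proof.
move=> nbr; rewrite /inactive_tree spanning_tree_contr.
have [tF /=|//] := boolP (spanning_tree (e |: inj F)).
have exch (f g : E') :
    e |: inj ((F :\ f) :|: [set g]) = ((e |: inj F) :\ val f) :|: [set val g].
  rewrite inj_exchange; apply/setP => h; rewrite !inE.
  by have [->|] := eqVneq h e; rewrite //= eq_sym (valP f).
have act (f : E') : f \in F ->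
    @int_active (contr H) r' F f = int_active r (e |: inj F) (val f).
  move=> fF; have vf : val f \in e |: inj F by rewrite in_setU1 in_inj fF orbT.
  apply/(@int_activeP (contr H) _ _ _ fF)/(int_activeP _ vf) => h g.
    have [->|ge] := eqVneq g e; first by move=> _; apply: r_max.
    rewrite -[g]/(val (exist (fun f => f != e) g ge)) -exch -spanning_tree_contr.
    exact: h.
  by rewrite spanning_tree_contr exch => /h.
apply/forall_inP/forall_inP => h f; last first.
  by move=> fF; rewrite act // h // in_setU1 in_inj fF orbT.
rewrite in_setU1 => /predU1P[->|/imsetP[f' f'F ->]]; last by rewrite -act // h.
have eF : e \in e |: inj F by rewrite setU11.
have [g ge tg] := tree_exchange tF eF nbr.
apply/negP => /(int_activeP _ eF)/(_ g tg) le.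
by case/eqP: ge; apply: r_inj; apply/eqP; rewrite eqn_leq r_max.
Qed.
End Contract.

Lemma card_inactive_notin :
  #|[set T | inactive_tree r T & e \notin T]| = @trees_no_int_active (del e) r'.
Proof.
rewrite !trees_no_int_activeE -(card_imset _ (imset_inj val_inj)); apply/eq_card => T.
rewrite inE; apply/andP/imsetP => [[tT eT]|[F]].
  exists [set f : E' | val f \in T]; last exact: inj_surj.
  by rewrite inE (inactive_tree_del _) -inj_surj.
by rewrite inE (inactive_tree_del _) => tF ->; rewrite tF notin_inj.
Qed.

Lemma card_inactive_in H : ~~ is_bridge e ->
  #|[set T | inactive_tree r T & e \in T]| = @trees_no_int_active (contr H) r'.
Proof.
move=> nbr; have addI : injective (fun F => e |: inj F).
  move=> F1 F2 /= /(congr1 (fun T => T :\ e)).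
  by rewrite !setU1K ?notin_inj // => /(imset_inj val_inj).
rewrite !trees_no_int_activeE -(card_imset _ addI); apply/eq_card => T.
rewrite inE; apply/andP/imsetP => [[tT eT]|[F]].
  have eT1 : e \notin T :\ e by rewrite !inE eqxx.
  exists [set f : E' | val f \in T :\ e]; last by rewrite -inj_surj // setD1K.
  have := inactive_tree_contr H [set f : E' | val f \in T :\ e] nbr.
  by rewrite -(inj_surj eT1) (setD1K eT) tT => tF; rewrite inE; exact: tF.
by rewrite inE (inactive_tree_contr H _ nbr) => tF ->; rewrite tF setU11.
Qed.

Lemma card_inactive_split : trees_no_int_active r =
  #|[set T | inactive_tree r T & e \notin T]| + #|[set T | inactive_tree r T & e \in T]|.
Proof.
rewrite !trees_no_int_activeE -(cardsID [set T : {set E} | e \notin T]).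
by congr (_ + _); apply: eq_card => T; rewrite !inE ?negbK andbC.
Qed.

Lemma inactive_loop : is_loop e -> trees_no_int_active r = @trees_no_int_active (del e) r'.
Proof.
move=> lp; rewrite card_inactive_split card_inactive_notin.
rewrite [X in _ + X]eq_card0 ?addn0 // => T.
by rewrite inE; apply/negP => /andP[/andP[tT _]]; rewrite (negbTE (tree_loop tT lp)).
Qed.

Lemma inactive_bridge : is_bridge e -> trees_no_int_active r = 0.
Proof.
by move=> br; apply: eq_card0 => T; rewrite inE; apply/negbTE/(inactive_tree_bridge _ _ br).
Qed.

Lemma inactive_del_contr H : ~~ is_bridge e -> trees_no_int_active r =
  @trees_no_int_active (del e) r' + @trees_no_int_active (contr H) r'.
Proof. by move=> nbr; rewrite card_inactive_split card_inactive_notin card_inactive_in. Qed.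
End TreeMinors.

(** * Edgeless graphs and the equality of the two counts *)

Lemma inactive_edgeless (G : graph) r : gconnected G -> #|gE G| = 0 ->
  @trees_no_int_active G r = 1.
Proof.
move=> conn E0; have all0 (F : {set gE G}) : F = set0.
  by apply/eqP; rewrite -cards_eq0 -leqn0 -E0 max_card.
rewrite -(cards1 (set0 : {set gE G})); apply: eq_card => F; rewrite (all0 F) !inE eqxx.
apply/andP; split; last by apply/forall_inP => f; rewrite inE.
apply/andP; split; last by apply/forall_inP => f; rewrite inE.
by rewrite -(all0 setT).
Qed.

Lemma alpha_edgeless (G : graph) : #|gE G| = 0 -> alpha G = 1.
Proof.
move=> E0; have all0 (F : {set gE G}) : F = set0.
  by apply/eqP; rewrite -cards_eq0 -leqn0 -E0 max_card.
have no_edge (f : gE G) : False by have := all0 [set f] => /setP/(_ f); rewrite !inE eqxx.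
pose eps0 : orientation G := [ffun => true].
rewrite /alpha (_ : BO G = [set eps0]) ?imset_set1 ?cards1 //.
apply/setP => eps; rewrite !inE.
rewrite (_ : eps = eps0) ?eqxx; last by apply/ffunP => f; case: (no_edge f).
by apply/forallP => C; rewrite (all0 C) eqxx.
Qed.

(** Induction on the number of edges, at the edge of largest rank: the tree recursion relies on this
    choice, the one for [alpha] holds at any edge. *)
Lemma alpha_inactive (G : graph) (r : gE G -> nat) :
  gconnected G -> injective r -> alpha G = trees_no_int_active r.
Proof.
move: {2}#|gE G| (erefl #|gE G|) => n; elim: n G r => [|n IH] G r En conn r_inj.
  by rewrite alpha_edgeless // inactive_edgeless.
have /card_gt0P[e0 _] : 0 < #|gE G| by rewrite En.
have [e _ max] := @arg_maxnP _ e0 predT r isT.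
have {}max f : r f <= r e by apply: max.
have cardn : #|gE (del e)| = n by move: En; rewrite (card_del e) => -[].
have r'_inj : injective (fun f : {f | f != e} => r (val f)).
  by move=> f g /r_inj/val_inj.
have [lp|H] := boolP (is_loop e).
  rewrite (alpha_loop conn lp) (inactive_loop max lp); apply: IH => //.
  by apply: gconnected_del; rewrite ?lp.
have [br|nbr] := boolP (is_bridge e).
  by rewrite (alpha_bridge conn br) (inactive_bridge _ br).
rewrite (alpha_del_contr H conn nbr) (inactive_del_contr r_inj max H nbr).
congr (_ + _); apply: IH => //; last exact: gconnected_contr.
by apply: gconnected_del; rewrite ?nbr ?orbT.
Qed.

(** * The Tutte polynomial at [x = 0], [y = 1] *)

(** As [tutte] is a relation, this keeps a claim about every [T] with [tutte G T] from being
    vacuous. *)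
Lemma tutte_exists (G : graph) : exists T, tutte G T.
Proof.
move: {2}#|gE G| (erefl #|gE G|) => n; elim: n G => [|n IH] G En.
  by exists 1%R; constructor.
have /card_gt0P[e _] : 0 < #|gE G| by rewrite En.
have cardn : #|gE (del e)| = n by move: En; rewrite (card_del e) => -[].
have [p tp] := IH (del e) cardn.
have [lp|H] := boolP (is_loop e); first by eexists; apply: tutte_loop lp tp.
have [q tq] := IH (contr H) cardn.
have [br|nbr] := boolP (is_bridge e); first by eexists; apply: tutte_bridge br tq.
by eexists; apply: tutte_other nbr tp tq.
Qed.

(** Induction on the derivation, which may treat the edges in any order: [tx] becomes 0, matching
    [alpha_bridge], and [ty] becomes 1, matching [alpha_loop]. *)
Lemma tutte_alpha (G : graph) T : tutte G T -> gconnected G ->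
  Posz (alpha G) = eval2 T 0%R 1%R.
Proof.
elim=> {G T} [G E0 _|G e H p br _ _ conn|G e p lp _ IH conn|
              G e H p q nbr _ IHp _ IHq conn].
- by rewrite alpha_edgeless // /eval2 !hornerE.
- by rewrite (alpha_bridge conn br) /eval2 /tx hornerM hornerX GRing.mul0r horner0.
- rewrite (alpha_loop conn lp) IH; last by apply: gconnected_del; rewrite ?lp.
  by rewrite /eval2 /ty hornerM hornerC hornerM hornerX GRing.mul1r.
- have connD : gconnected (del e) by apply: gconnected_del; rewrite ?nbr ?orbT.
  have connC := gconnected_contr H conn.
  rewrite /eval2 !hornerD -![_.[_].[_]%R]/(eval2 _ _ _) -(IHp connD) -(IHq connC).
  by rewrite -PoszD; congr Posz; apply: alpha_del_contr.
Qed.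

Theorem theorem1 (G : graph) :
  gconnected G ->
  (exists T, tutte G T) /\
  (forall T, tutte G T -> Posz (alpha G) = eval2 T 0%R 1%R) /\
  (forall r : gE G -> nat, injective r -> alpha G = trees_no_int_active r).
Proof.
move=> conn; split; first exact: tutte_exists.
by split=> [T tT|r r_inj]; [apply: tutte_alpha | apply: alpha_inactive].
Qed.
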